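(* The following hold. (1) For all nonnegative integers $n$, $p_2(1;n) = 2$ if $n-2 = \frac{m(m+1)}{2}$ for some nonnegative integer $m$, and $p_2(1;n)=0$ otherwise. (2) For all integers $n>2$, $p_3(1;n) = 3\sum_{d\mid 3n-8}\left(\frac{d}{3}\right)$. (3) For all integers $n>5$, $p_3(2;n) = 9\sum_{d\mid 3n-17}\left(\frac{d}{3}\right)$. Here the sums run over positive divisors $d$ and $\left(\frac{d}{3}\right)$ is the Legendre symbol.
   Context: For a partition $\lambda$ of $n$, the hook length of a box $(i,j)$ in its Ferrers–Young diagram is the number of boxes consisting of $(i,j)$ and the boxes directly to its right and directly below it; $H(\lambda)$ is the product of all hook lengths of $\lambda$. For a prime $\ell$ and nonnegative integer $a$, $p_\ell(a;n) := \#\{\lambda\vdash n : \mathrm{ord}_\ell(H(\lambda)) = a\}$. *)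

(* Defs.v *)
From HB Require Import structures.
From mathcomp Require Import all_boot all_order all_algebra.

Set Implicit Arguments.
Unset Strict Implicit.
Unset Printing Implicit Defensive.

Definition is_intpartn (n : nat) (s : seq nat) : bool :=
  [&& sorted geq s, 0 \notin s & sumn s == n].

Record intpartn (n : nat) : Type :=
  IntPartn { parts :> seq nat; partsP : is_intpartn n parts }.

HB.instance Definition _ (n : nat) := [isSub for @parts n].
HB.instance Definition _ (n : nat) := [Countable of intpartn n by <:].

Lemma mem_leq_sumn (s : seq nat) (x : nat) : x \in s -> x <= sumn s.
Proof.
elim: s => //= y s IHs; rewrite inE => /predU1P[->|/IHs le_xs].
  exact: leq_addr.
exact: leq_trans le_xs (leq_addl _ _).
Qed.

Lemma size_leq_sumn (s : seq nat) : 0 \notin s -> size s <= sumn s.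
Proof.
elim: s => //= y s IHs; rewrite inE negb_or eq_sym -lt0n => /andP[y_gt0 /IHs].
by rewrite -add1n; apply: leq_add.
Qed.

(* A partition of n has at most n parts, each at most n. *)
Definition intpartn_code (n : nat) (la : intpartn n) : {bseq n of 'I_n.+1} :=
  insub_bseq n (map inord la).
Definition intpartn_decode (n : nat) (b : {bseq n of 'I_n.+1}) : option (intpartn n) :=
  insub (map (@nat_of_ord n.+1) b).

Lemma intpartn_codeK (n : nat) : pcancel (@intpartn_code n) (@intpartn_decode n).
Proof.
case=> s sP; rewrite /intpartn_code /intpartn_decode /=.
have [_ s0 /eqP sn] := and3P sP.
have code_val : insub_bseq n (map inord s) = map inord s :> seq 'I_n.+1.
  by rewrite insubdK // -topredE /= size_map -sn size_leq_sumn.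
rewrite code_val -map_comp map_id_in => [|x xs] /=; first exact: (valK (IntPartn sP)).
by rewrite inordK // ltnS -sn mem_leq_sumn.
Qed.

HB.instance Definition _ (n : nat) : isFinite (intpartn n) :=
  PCanIsFinite (@intpartn_codeK n).

(* Rows and columns of the diagram are numbered from 0. *)
Definition boxes (la : seq nat) : seq (nat * nat) :=
  [seq (i, j) | i <- iota 0 (size la), j <- iota 0 (nth 0 la i)].

Definition in_hook (b c : nat * nat) : bool :=
  (c.1 == b.1) && (b.2 <= c.2) || (c.2 == b.2) && (b.1 <= c.1).

Definition hook_length (la : seq nat) (b : nat * nat) : nat :=
  count (in_hook b) (boxes la).

Definition hook_product (la : seq nat) : nat :=
  \prod_(b <- boxes la) hook_length la b.

(* p_l(a; n); as l is prime and hook products are positive, logn is ord_l. *)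
Definition num_intpartn_ord (l a n : nat) : nat :=
  #|[set la : intpartn n | logn l (hook_product la) == a]|.

(* Meaningful for p an odd prime. *)
Definition legendre (a : int) (p : nat) : int :=
  if (p%:Z %| a)%Z then 0%R
  else if [exists x : 'I_p, (x%:Z ^+ 2 == a %[mod p%:Z])%R%Z] then 1%R
  else (-1)%R.

(* Main.v *)
Require Import Defs.
From HB Require Import structures.
From mathcomp Require Import all_boot all_order all_algebra.
From mathcomp Require Import fingroup pgroup finfield finmap zify ring.

(** A partition is read off the 0-1 word of its boundary path, and its hook
    lengths are the distances between the inverted letters of the word.  Cutting
    the word into its residue classes mod l (the runners of the l-abacus) keeps
    exactly the hooks divisible by l, divided by l.  Hence, for a < l prime,
    ord_l H(la) = a iff the runners have a inversions in total, and then
    |la| = l a + |core|, where the core depends only on the number of letters of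
    each kind on each runner.  Counting the runners with few inversions gives
    the factors 2, 3 and 9, times the number of l-cores of size m = n - l a.
    The 2-cores have the sizes b(2b+1) with b an integer, i.e. the triangular
    numbers, each once.  The 3-cores of size m correspond to the Eisenstein
    integers of norm 3m + 1 that are 1 mod 3.  The number r(m) of Eisenstein
    integers of norm m that are 1 mod 3 satisfies, for every prime p <> 3, the
    Hecke relation r(p m) = (1 + chi p) r(m) - chi p r(m / p), chi = (./3), which
    also characterises the divisor sums of chi. *)

Set Implicit Arguments.
Unset Strict Implicit.
Unset Printing Implicit Defensive.

Import GRing.Theory Num.Theory Order.Theory.

(** * Boundary words *)

Fixpoint true_sum (F : nat -> nat) (u : seq bool) : nat :=
  if u is b :: v then (if b then F 0 else 0) + true_sum (F \o S) v else 0.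

(* An inversion is a letter false followed, d > 0 places later, by a letter
   true; inversion_sum F sums F d over all inversions. *)
Fixpoint inversion_sum (F : nat -> nat) (u : seq bool) : nat :=
  if u is b :: v then (if b then 0 else true_sum (F \o S) v) + inversion_sum F v else 0.

Definition inversions := inversion_sum (fun=> 1).

(* The letters false are the rows: a row is as long as the number of letters
   true that follow it. *)
Fixpoint word_parts (u : seq bool) : seq nat :=
  if u is b :: v then
    if b || (count id v == 0) then word_parts v else count id v :: word_parts v
  else [::].

Lemma word_parts_le u x : x \in word_parts u -> x <= count id u.
Proof.
elim: u => //= b v IHv; case: ifP => _; first by move/IHv; lia.
by rewrite inE => /predU1P[->|/IHv]; lia.
Qed.

Lemma sorted_word_parts u : sorted geq (word_parts u).
Proof.
elim: u => //= b v IHv; case: ifP => _ //=; rewrite path_min_sorted //.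
by apply/allP => x /word_parts_le.
Qed.

Lemma word_parts_gt0 u : 0 \notin word_parts u.
Proof.
elim: u => //= b v IHv; case: ifP => // /norP[_].
by rewrite inE negb_or IHv andbT eq_sym.
Qed.

(** The hook of box [j] of the new row has [x - j] boxes along the row and one more for each lower
    row longer than [j]; hooks of lower rows do not meet the new row. *)
Lemma sum_boxes_cons F x la :
  \sum_(b <- boxes (x :: la)) F (hook_length (x :: la) b) =
  \sum_(0 <= j < x) F ((x - j) + count (fun y => j < y) la)
  + \sum_(b <- boxes la) F (hook_length la b).
Proof.
have boxesE : boxes (x :: la) = [seq (0, j) | j <- iota 0 x] ++
    [seq (b.1.+1, b.2) | b <- boxes la].
  rewrite /boxes /= ; congr cat.
  by rewrite map_allpairs (iotaDl 1 0) allpairs_mapl.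
rewrite {1}boxesE big_cat /= !big_map; congr (_ + _).
  rewrite [RHS]big_mkord -(big_mkord xpredT (fun j => F (x - j + count (fun y => j < y) la))).
  rewrite /index_iota subn0 big_seq_cond [RHS]big_seq_cond; apply: eq_bigr => j.
  rewrite mem_iota add0n andbT => /andP[_ jx]; congr F.
  rewrite /hook_length boxesE count_cat !count_map; congr (_ + _).
    rewrite (eq_count (a2 := fun c => j <= c)); last first.
      by move=> c; rewrite /in_hook /= andbT orb_idr // => /eqP ->.
    have -> : iota 0 x = iota 0 j ++ iota j (x - j) by rewrite -iotaD subnKC // ltnW.
    rewrite count_cat; have /eqP -> : count (fun c => j <= c) (iota 0 j) == 0.
      by rewrite -leqn0 leqNgt -has_count; apply/hasPn => c; rewrite mem_iota /= -ltnNge.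
    rewrite add0n; rewrite -[RHS](size_iota j); apply/eqP; rewrite -all_count.
    by apply/allP => c; rewrite mem_iota => /andP[].
  rewrite (eq_count (a2 := preim snd (pred1 j))); last first.
    by move=> c; rewrite /in_hook /= andbT.
  rewrite -count_map /boxes map_allpairs /=; elim: la {boxesE} => //= y la IHla.
  rewrite count_cat (iotaDl 1 0) allpairs_mapl IHla map_id; congr (_ + _).
  by rewrite count_uniq_mem ?iota_uniq // mem_iota.
apply: eq_bigr => b _; congr F.
rewrite /hook_length boxesE count_cat !count_map.
rewrite (eq_count (a2 := pred0)) ?count_pred0; last by move=> c; rewrite /in_hook /= andbF.
by apply: eq_count => c; rewrite /in_hook /= eqSS ltnS.
Qed.

(** Here [u] is what follows a letter false. Column [j] belongs to the letter true of rank
    [count id u - j]. The letters true up to it count the boxes along the row, and the letters false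
    before it are the lower rows longer than [j]. The hook length is thus its distance to the
    initial false. *)
Lemma first_row_word F u :
  \sum_(0 <= j < count id u) F ((count id u - j) + count (fun y => j < y) (word_parts u)) =
  true_sum (F \o S) u.
Proof.
elim: u F => [|b v IHv] F /=; first by rewrite big_nil.
case: b => /=.
  rewrite add1n big_nat_recr //= addnC; congr (_ + _).
    rewrite subSnn; have /eqP -> : count (fun y => count id v < y) (word_parts v) == 0.
      rewrite -leqn0 leqNgt -has_count; apply/hasPn => y /word_parts_le.
      by rewrite -leqNgt.
    by [].
  rewrite -IHv [LHS]big_seq_cond [RHS]big_seq_cond; apply: eq_bigr => j.
  by rewrite andbT mem_index_iota => /andP[_ jv] /=; rewrite subSn // ltnW.
rewrite -IHv [LHS]big_seq_cond [RHS]big_seq_cond; apply: eq_bigr => j.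
rewrite andbT mem_index_iota => /andP[_ jv] /=.
have -> : (count id v == 0) = false by case: (count id v) jv.
by rewrite /= jv add0n addnCA add1n.
Qed.

Lemma true_sum0 F u : count id u = 0 -> true_sum F u = 0.
Proof. by elim: u F => //= -[] v IHv F //= /IHv ->. Qed.

Lemma sum_hook_word F u :
  \sum_(b <- boxes (word_parts u)) F (hook_length (word_parts u) b) = inversion_sum F u.
Proof.
elim: u => [|b v IHv] /=; first by rewrite big_nil.
case: b => //=; case: eqP => [v0|_]; first by rewrite IHv true_sum0.
by rewrite sum_boxes_cons IHv first_row_word.
Qed.

Lemma size_boxes la : size (boxes la) = sumn la.
Proof.
rewrite size_allpairs_dep; congr sumn.
by rewrite -[in RHS](mkseq_nth 0 la) /mkseq; apply: eq_map => i; rewrite size_iota.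
Qed.

Lemma sumn_word_parts u : sumn (word_parts u) = inversions u.
Proof. by rewrite -size_boxes -sum1_size -[RHS]sum_hook_word. Qed.

Lemma hook_length_gt0 la b : b \in boxes la -> 0 < hook_length la b.
Proof.
by move=> bla; rewrite -has_count; apply/hasP; exists b; rewrite // /in_hook !eqxx leqnn.
Qed.

Lemma logn_hook_product l u :
  logn l (hook_product (word_parts u)) = inversion_sum (logn l) u.
Proof.
rewrite -sum_hook_word /hook_product; move: (word_parts u) => la.
have : all (fun b => 0 < hook_length la b) (boxes la) by apply/allP => b /hook_length_gt0.
elim: (boxes la) => [|b bs IHbs] /=; first by rewrite !big_nil logn1.
move=> /andP[b0 bs0]; rewrite !big_cons lognM ?IHbs //.
by rewrite big_seq_cond prodn_cond_gt0 // => c /andP[cbs _]; apply: (allP bs0).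
Qed.

(* A hook is at most the size of its partition, so an inversion of length d forces d inversions. *)
Lemma eq_inversion_sum F G u : (forall d, 0 < d <= inversions u -> F d = G d) ->
  inversion_sum F u = inversion_sum G u.
Proof.
move=> FG; rewrite -!sum_hook_word; apply: eq_big_seq => b bu.
by apply: FG; rewrite hook_length_gt0 // -sumn_word_parts -size_boxes count_size.
Qed.

(** Leading letters true and trailing letters false leave no trace in the parts, whence the
    numerical hypotheses. If the first letters differ, the word starting with false has a part equal
    to the total number of letters true, too large for the other word. *)
Lemma word_parts_inj u v : size u = size v -> count id u = count id v ->
  word_parts u = word_parts v -> u = v.
Proof.
elim: u v => [|b u IHu] [|c v] //= [suv].
have aux (s t : seq bool) : size s = size t -> (count id s).+1 = count id t ->
   word_parts s = (if count id t == 0 then word_parts t else count id t :: word_parts t) -> False.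
  move=> _ st; rewrite -st /= => e; have := @word_parts_le s (count id s).+1.
  by rewrite e mem_head ltnn => /(_ isT).
case: b; case: c => //=; rewrite ?add0n ?add1n.
- by move=> [cuv] /(IHu _ suv cuv) ->.
- by move=> cuv e; case: (aux u v).
- by move=> cuv e; case: (aux v u).
move=> cuv; rewrite cuv; case: ifP => _; first by move/(IHu _ suv cuv) ->.
by case=> /(IHu _ suv cuv) ->.
Qed.

Lemma word_parts_surj k z la : sorted geq la -> 0 \notin la ->
  all (fun x => x <= k) la -> size la <= z ->
  exists u, [/\ size u = k + z, count id u = k & word_parts u = la].
Proof.
elim: la k z => [|x la IHla] k z /=.
  move=> _ _ _ _; exists (nseq k true ++ nseq z false).
  rewrite size_cat !size_nseq count_cat !count_nseq mul1n mul0n addn0; split=> //.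
  by elim: k => [|k IHk] //=; elim: z => //= z ->; rewrite count_nseq.
case: z => // z; rewrite path_sortedE; last by move=> a b c /= ba ac; apply: leq_trans ba.
move=> /andP[xla sla]; rewrite inE negb_or eq_sym -lt0n => /andP[x0 la0] /andP[xk _] sz.
have [u [su cu pu]] := IHla x z sla la0 xla sz.
(* All but [x] of the [k] letters true precede the row of length [x]. *)
exists (nseq (k - x) true ++ false :: u); rewrite size_cat count_cat size_nseq count_nseq /= su cu.
split; [lia|lia|].
elim: (k - x) => [|m IHm] //=; rewrite cu pu; by case: x x0 {xla xk IHla cu su}.
Qed.

(** * Explicit sums over letters and inversions *)

Lemma true_sumE F u : true_sum F u = \sum_(0 <= j < size u | nth false u j) F j.
Proof.
elim: u F => [|b v IHv] F /=; first by rewrite big_geq.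
by rewrite IHv big_mkcond [RHS]big_mkcond big_nat_recl.
Qed.

Lemma inversion_sumE F u : inversion_sum F u =
  \sum_(0 <= j < size u) \sum_(0 <= i < size u)
    if [&& i < j, ~~ nth false u i & nth false u j] then F (j - i) else 0.
Proof.
elim: u => [|b v IHv] /=; first by rewrite big_geq.
rewrite big_nat_recl // big1 ?add0n // IHv.
have -> : (if b then 0 else true_sum (F \o S) v) =
    \sum_(0 <= j < size v) (if ~~ b && nth false v j then F j.+1 else 0).
  by rewrite true_sumE big_mkcond; case: b => //=; rewrite big1.
rewrite -big_split; apply: eq_bigr => j _ /=.
by rewrite big_nat_recl // ltn0Sn subn0.
Qed.

Lemma true_sum_count u : true_sum (fun=> 1) u = count id u.
Proof. by elim: u => //= -[] v /= ->. Qed.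

Lemma true_sumD F G u : true_sum (fun d => F d + G d) u = true_sum F u + true_sum G u.
Proof. by rewrite !true_sumE big_split. Qed.

Lemma true_sumZ c F u : true_sum (fun d => c * F d) u = c * true_sum F u.
Proof. by rewrite !true_sumE big_distrr. Qed.

(** The position of a letter true is the number of letters false before it, i.e. its inversions,
    plus its rank among the letters true; the ranks add up to the binomial. *)
Lemma inversions_positions u : true_sum id u = inversions u + 'C(count id u, 2).
Proof.
elim: u => //= b v IHv.
have -> : true_sum (id \o S) v = true_sum (fun d => 1 + id d) v by [].
have -> : inversions (b :: v) = (if b then 0 else count id v) + inversions v.
  by rewrite -true_sum_count.
by rewrite true_sumD true_sum_count IHv; case: b; rewrite ?add1n ?add0n ?binS ?bin1; lia.
Qed.

(** * Abacus runners *)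

Definition runner (l L r : nat) (u : seq bool) : seq bool :=
  mkseq (fun q => nth false u (q * l + r)) L.

Lemma big_nat_runners l L (F : nat -> nat) :
  \sum_(0 <= j < L * l) F j = \sum_(0 <= r < l) \sum_(0 <= q < L) F (q * l + r).
Proof.
elim: L => [|L IHL].
  by rewrite mul0n big_geq // big1 // => r _; rewrite big_geq.
rewrite mulSn addnC (big_cat_nat (n := L * l)) ?leq_addr //= IHL.
rewrite -{1}[L * l]add0n big_addn addKn -big_split.
by apply: eq_bigr => r _; rewrite big_nat_recr // addnC.
Qed.

(** Inversions between different runners have length prime to [l] and contribute 0; one of length
    [d] on a runner has length [l * d] in [u]. *)
Lemma inversion_sum_runners l L u : prime l -> size u = L * l ->
  inversion_sum (logn l) u =
  \sum_(0 <= r < l) inversion_sum (fun d => (logn l d).+1) (runner l L r u).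
Proof.
move=> lp su; have l0 := prime_gt0 lp.
rewrite inversion_sumE su big_nat_runners; apply: eq_big_nat => r /andP[_ rl].
rewrite inversion_sumE size_mkseq; apply: eq_big_nat => q /andP[_ qL].
rewrite big_nat_runners (bigD1_seq r) ?mem_index_iota ?iota_uniq //=.
rewrite [X in _ + X]big1_seq ?addn0 => [|s /andP[sr]].
  apply: eq_big_nat => p /andP[_ pL].
  rewrite !nth_mkseq // ltn_add2r ltn_pmul2r // subnDr -mulnBl mulnC.
  case: ifP => // /andP[pq _]; by rewrite lognM ?subn_gt0 // (logn_prime l lp) eqxx addn1.
move=> /[!mem_index_iota] /andP[_ sl]; apply: big1_seq => p _; case: ifP => // /andP[pq _].
apply: logn_coprime; rewrite prime_coprime //; apply: contra sr => dv.
have := eqn_mod_dvd l (ltnW pq); rewrite dv !modnMDl !modn_small // => /eqP ->.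
by [].
Qed.

Lemma true_sum_runners F l L u : size u = L * l ->
  true_sum F u = \sum_(0 <= r < l) true_sum (fun q => F (q * l + r)) (runner l L r u).
Proof.
move=> su; rewrite true_sumE su big_mkcond big_nat_runners; apply: eq_bigr => r _.
rewrite true_sumE size_mkseq [RHS]big_mkcond; apply: eq_big_nat => q /andP[_ qL].
by rewrite nth_mkseq.
Qed.

Lemma count_runners l L u : size u = L * l ->
  count id u = \sum_(0 <= r < l) count id (runner l L r u).
Proof.
move=> su; rewrite -true_sum_count (true_sum_runners _ su).
by apply: eq_bigr => r _; rewrite true_sum_count.
Qed.

(** [inversions_positions] is applied to [u] and to each runner, place [q] of runner [r] being
    position [q * l + r]. *)
Lemma inversions_runners l L u : size u = L * l ->
  inversions u + 'C(count id u, 2) =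
  \sum_(0 <= r < l) (l * (inversions (runner l L r u) + 'C(count id (runner l L r u), 2))
                     + r * count id (runner l L r u)).
Proof.
move=> su; rewrite -inversions_positions (true_sum_runners _ su); apply: eq_bigr => r _.
rewrite -inversions_positions -true_sumZ -true_sum_count -true_sumZ -true_sumD.
by rewrite !true_sumE; apply: eq_bigr => q _; rewrite mulnC muln1.
Qed.

(** With fewer than [l] inversions on the runners, none is of length [l] or more, so the extra
    [logn] terms vanish. Otherwise both sums are at least [l], hence differ from [a]. *)
Lemma logn_inversion_sum_eq l L u a : prime l -> a < l -> size u = L * l ->
  (inversion_sum (logn l) u == a) = (\sum_(0 <= r < l) inversions (runner l L r u) == a).
Proof.
move=> lp al su; rewrite (inversion_sum_runners lp su).
have ge : \sum_(0 <= r < l) inversions (runner l L r u) <=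
    \sum_(0 <= r < l) inversion_sum (fun d => (logn l d).+1) (runner l L r u).
  apply: leq_sum => r _; rewrite /inversions !inversion_sumE.
  by apply: leq_sum => j _; apply: leq_sum => i _; case: ifP.
have [Tl|Tl] := ltnP (\sum_(0 <= r < l) inversions (runner l L r u)) l; last first.
  by rewrite !gtn_eqF // (leq_trans al) // (leq_trans Tl).
congr (_ == _); apply: eq_big_nat => r /andP[_ rl]; apply: eq_inversion_sum => d /andP[d0 dr].
rewrite logn_coprime // prime_coprime // gtnNdvd // (leq_ltn_trans dr) //.
apply: leq_ltn_trans Tl; rewrite (bigD1_seq r) ?mem_index_iota ?iota_uniq //=.
exact: leq_addr.
Qed.

(** Parts are at most [n <= k] and there are at most [n <= M - k] of them, so every partition of [n]
    fits in the frame of [k] columns and [M - k] rows. *)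
Lemma card_intpartn_words n M k (Q : pred (seq nat)) : n <= k -> n + k <= M ->
  #|[set la : intpartn n | Q la]| =
  #|[set u : M.-tuple bool | [&& count id u == k, inversions u == n & Q (word_parts u)]]|.
Proof.
move=> nk kM; set A := [set la | _]; set B := [set u | _].
rewrite !cardE -(size_map val) -(size_map (fun u : M.-tuple bool => word_parts u) (enum B)).
apply/perm_size/uniq_perm => [||la].
- by rewrite map_inj_uniq ?enum_uniq //; apply: val_inj.
- rewrite map_inj_in_uniq ?enum_uniq // => u v; rewrite !mem_enum !inE.
  move=> /andP[/eqP cu _] /andP[/eqP cv _] uv; apply/val_inj/word_parts_inj => //.
    by rewrite !size_tuple.
  by rewrite cu cv.
apply/mapP/mapP => [[mu]|[u]]; rewrite mem_enum inE.
  move=> Qmu ->; have /and3P[smu mu0 /eqP mun] := valP mu.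
  have muk : all (fun x => x <= k) (val mu).
    by apply/allP => x /mem_leq_sumn xmu; apply: leq_trans nk; rewrite -mun.
  have szmu : size (val mu) <= M - k by rewrite (leq_trans (size_leq_sumn mu0)) // mun; lia.
  have [u [su cu pu]] := word_parts_surj smu mu0 muk szmu.
  have {}su : size u == M by rewrite su subnKC //; lia.
  by exists (Tuple su); rewrite ?mem_enum ?inE /= -?sumn_word_parts ?cu ?pu ?mun ?eqxx.
case/and3P => /eqP cu /eqP iu Qu lu.
have iu' : is_intpartn n (word_parts u).
  by rewrite /is_intpartn sorted_word_parts word_parts_gt0 sumn_word_parts iu eqxx.
by exists (IntPartn iu'); rewrite // mem_enum inE.
Qed.

(** * Partitions of 0, 1 and 2 *)

Lemma card_intpartn0 : #|{: intpartn 0}| = 1.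
Proof.
rewrite cardE -(size_map val) -[RHS]/(size [:: [::] : seq nat]).
apply/perm_size/uniq_perm => // [|s]; first by rewrite map_inj_uniq ?enum_uniq //; apply: val_inj.
rewrite inE; apply/mapP/eqP => [[la _ ->]|->]; last first.
  by exists (IntPartn (isT : is_intpartn 0 [::])); rewrite ?mem_enum.
by case: la => -[|x s'] //= /and3P[_]; rewrite inE; case: x.
Qed.

Lemma card_intpartn1 : #|{: intpartn 1}| = 1.
Proof.
rewrite cardE -(size_map val) -[RHS]/(size [:: [:: 1]]).
apply/perm_size/uniq_perm => // [|s]; first by rewrite map_inj_uniq ?enum_uniq //; apply: val_inj.
rewrite inE; apply/mapP/eqP => [[la _ ->]|->]; last first.
  by exists (IntPartn (isT : is_intpartn 1 [:: 1])); rewrite ?mem_enum.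
by case: la => -[|[|[|x]] [|[|y] s']] //= /and3P[_]; rewrite ?inE.
Qed.

Lemma card_intpartn2 : #|{: intpartn 2}| = 2.
Proof.
rewrite cardE -(size_map val) -[RHS]/(size [:: [:: 2]; [:: 1; 1]]).
apply/perm_size/uniq_perm => // [|s]; first by rewrite map_inj_uniq ?enum_uniq //; apply: val_inj.
rewrite !inE; apply/mapP/orP => [[la _ ->]|[] /eqP ->].
- by case: la => -[|[|[|[|x]]] [|[|[|y]] [|[|z] s']]] //= /and3P[_]; rewrite ?inE //; auto.
- by exists (IntPartn (isT : is_intpartn 2 [:: 2])); rewrite ?mem_enum.
- by exists (IntPartn (isT : is_intpartn 2 [:: 1; 1])); rewrite ?mem_enum.
Qed.

Lemma card_words_inversions L k t : t <= k -> t + k <= L ->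
  #|[set v : L.-tuple bool | (count id v == k) && (inversions v == t)]| = #|{: intpartn t}|.
Proof.
move=> tk kL; have -> : #|{: intpartn t}| = #|[set la : intpartn t | predT (val la)]|.
  by rewrite -cardsT; apply: eq_card => la; rewrite !inE.
by rewrite (card_intpartn_words _ tk kL); apply: eq_card => v; rewrite !inE andbT.
Qed.

(** * Grouping words by their core *)

Section Runners.

Variables l L : nat.

Definition tuple_runners (u : (L * l).-tuple bool) : {ffun 'I_l -> L.-tuple bool} :=
  [ffun r : 'I_l => [tuple nth false u (q * l + r) | q < L]].

Lemma val_tuple_runners u r : tuple_runners u r = runner l L r u :> seq bool.
Proof.
apply: (@eq_from_nth _ false) => [|q]; first by rewrite size_tuple size_mkseq.
rewrite size_tuple => qL; rewrite ffunE nth_mkseq //.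
by rewrite -[q]/(val (Ordinal qL)) -tnth_nth tnth_mktuple.
Qed.

Lemma tuple_runners_inj : injective tuple_runners.
Proof.
move=> u v uv; apply/val_inj/(@eq_from_nth _ false) => [|j]; first by rewrite !size_tuple.
rewrite size_tuple => jLl; have l0 : 0 < l by case: (l) jLl; rewrite ?muln0.
have qL : j %/ l < L by rewrite ltn_divLR.
have rl : j %% l < l by rewrite ltn_mod.
have := congr1 (fun f : {ffun 'I_l -> L.-tuple bool} => nth false (f (Ordinal rl)) (j %/ l)) uv.
by rewrite !val_tuple_runners !nth_mkseq // -divn_eq.
Qed.

Lemma tuple_runners_bij : bijective tuple_runners.
Proof.
apply: inj_card_bij; first exact: tuple_runners_inj.
by rewrite card_ffun !card_tuple card_bool card_ord expnM.
Qed.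

(* The l-core with c r letters true on runner r, k in total, has size
   core_size c - 'C(k, 2). *)
Definition core_size (c : 'I_l -> nat) : nat :=
  \sum_(r < l) (l * 'C(c r, 2) + r * c r).

(** The l-cores of size [m] that fit in the frame. The binomial stands on the left to avoid a
    truncated subtraction. *)
Definition occupations (k m : nat) : {set {ffun 'I_l -> 'I_L.+1}} :=
  [set c : {ffun 'I_l -> 'I_L.+1} |
    (\sum_(r < l) c r == k) && (m + 'C(k, 2) == core_size (fun r => c r))].

(** The l-quotients of total size [a] above the core [c]. *)
Definition fiber (a : nat) (c : {ffun 'I_l -> 'I_L.+1}) : {set {ffun 'I_l -> L.-tuple bool}} :=
  [set f : {ffun 'I_l -> L.-tuple bool} |
    [forall r, count id (f r) == c r] && (\sum_(r < l) inversions (f r) == a)].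

(** When the runners have [a] inversions in total, [inversions_runners] turns size [n] of the
    partition into size [n - l * a] of the core; the words are then sorted by occupation. *)
Lemma num_intpartn_ord_fibers a k n : prime l -> a < l -> n <= k -> n + k <= L * l -> l * a <= n ->
  num_intpartn_ord l a n = \sum_(c in occupations k (n - l * a)) #|fiber a c|.
Proof.
move=> lp al nk kM lan.
rewrite /num_intpartn_ord (card_intpartn_words (fun la => logn l (hook_product la) == a) nk kM).
pose B := [set f : {ffun 'I_l -> L.-tuple bool} |
  [&& \sum_(r < l) count id (f r) == k,
      n - l * a + 'C(k, 2) == core_size (fun r => count id (f r)) &
      \sum_(r < l) inversions (f r) == a]].
have -> : [set u : (L * l).-tuple bool | [&& count id u == k, inversions u == n &
      logn l (hook_product (word_parts u)) == a]] = tuple_runners @^-1: B.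
  apply/setP => u; rewrite !inE logn_hook_product.
  rewrite (logn_inversion_sum_eq lp al (size_tuple u)).
  have := inversions_runners (size_tuple u); rewrite (count_runners (size_tuple u)) !big_mkord.
  under [X in _ = X -> _]eq_bigr => r _ do rewrite -val_tuple_runners mulnDr -addnA.
  under [X in _ + 'C(X, 2) = _ -> _]eq_bigr => r _ do rewrite -val_tuple_runners.
  under [X in [&& X == k, _ & _] = _]eq_bigr => r _ do rewrite -val_tuple_runners.
  under [X in [&& _, _ & X == a] = _]eq_bigr => r _ do rewrite -val_tuple_runners.
  rewrite big_split -big_distrr /= -/(core_size (fun r => count id (tuple_runners u r))).
  by case: eqP => //= ->; case: (_ =P a) => [->|]; rewrite ?andbF ?andbT //; lia.
rewrite on_card_preimset; last exact: onW_bij tuple_runners_bij.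
rewrite -sum1_card.
pose occ (f : {ffun 'I_l -> L.-tuple bool}) : {ffun 'I_l -> 'I_L.+1} :=
  [ffun r => inord (count id (f r))].
have occE f r : occ f r = count id (f r) :> nat.
  by rewrite ffunE inordK // ltnS -[X in _ <= X](size_tuple (f r)) count_size.
rewrite (partition_big occ (fun c => c \in occupations k (n - l * a))) => [|f].
  apply: eq_bigr => c; rewrite inE => /andP[/eqP ck /eqP cm].
  rewrite sum1dep_card; apply: eq_card => f; rewrite !inE.
  apply/andP/andP => [[/and3P[_ _ fa] /eqP <-]|[/forallP fc fa]].
    by split=> //; apply/forallP => r; rewrite occE.
  split; last by apply/eqP/ffunP => r; apply/val_inj; rewrite /= occE; apply/eqP.
  rewrite fa andbT /core_size; apply/andP; split.
    by rewrite -ck; apply/eqP/eq_bigr => r _; rewrite (eqP (fc r)).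
  by rewrite cm; apply/eqP/eq_bigr => r _; rewrite (eqP (fc r)).
rewrite !inE => /and3P[/eqP <- /eqP -> _]; apply/andP; split; apply/eqP.
  by apply: eq_bigr => r _; rewrite occE.
by rewrite /core_size; apply: eq_bigr => r _; rewrite occE.
Qed.

End Runners.

Lemma inversion_sum0 F u : (forall d, F d = 0) -> inversion_sum F u = 0.
Proof.
move=> F0; rewrite inversion_sumE big1 // => j _; rewrite big1 // => i _.
by rewrite F0 if_same.
Qed.

(** Every hook is shorter than [l], hence prime to [l]. *)
Lemma num_intpartn_ord_lt l a n : prime l -> n < l -> 0 < a -> num_intpartn_ord l a n = 0.
Proof.
move=> lp nl a0; rewrite /num_intpartn_ord.
rewrite (card_intpartn_words (fun la => logn l (hook_product la) == a) (leqnn n) (leqnn _)).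
apply: eq_card0 => u; rewrite !inE logn_hook_product.
apply/negP => /and3P[_ /eqP iu]; rewrite (@eq_inversion_sum _ (fun=> 0)).
  by rewrite inversion_sum0 // eq_sym gtn_eqF.
move=> d /andP[d0]; rewrite iu => dn; rewrite logn_coprime // prime_coprime //.
by rewrite gtnNdvd // (leq_ltn_trans dn).
Qed.

(** * Generating polynomials of the runners *)

Section Fibers.
Local Open Scope ring_scope.

(** The Gaussian binomial coefficient of [L] and [k]. *)
Definition inversion_poly (L k : nat) : {poly int} :=
  \sum_(v : L.-tuple bool | count id v == k) 'X^(inversions v).

(** The runners are chosen independently, so their generating polynomials multiply. *)
Lemma card_fiber l L a (c : {ffun 'I_l -> 'I_L.+1}) :
  (#|fiber a c|)%:R = (\prod_(r < l) inversion_poly L (c r))`_a.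
Proof.
rewrite bigA_distr_big_dep coef_sum -sum1_card natr_sum /=.
rewrite big_mkcond [RHS]big_mkcond; apply: eq_bigr => f _.
rewrite inE prodrXr coefXn /= eq_sym.
have -> : (f \in family (fun r (v : L.-tuple bool) => count id v == c r)) =
    [forall r, count id (f r) == c r] by [].
by case: [forall r, _] => //=; case: eqP.
Qed.

Lemma coef_inversion_poly L k t : (t <= k)%N -> (t + k <= L)%N ->
  (inversion_poly L k)`_t = (#|{: intpartn t}|)%:R.
Proof.
move=> tk kL; rewrite -(card_words_inversions tk kL) coef_sum -sum1_card natr_sum.
rewrite big_mkcond [RHS]big_mkcond; apply: eq_bigr => v _.
by rewrite inE coefXn [t == _]eq_sym; case: (count id v == k); case: eqP.
Qed.

(** The bounds on [c r] put the coefficients in the range where they are partition numbers; 2 is the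
    coefficient of X in (1 + X)^2. *)
Lemma card_fiber_2_1 L (c : {ffun 'I_2 -> 'I_L.+1}) :
  (forall r, 1 <= c r)%N -> (forall r, c r + 1 <= L)%N -> #|fiber 1 c| = 2%N.
Proof.
move=> c1 cL; apply/eqP; rewrite -(eqr_nat int) card_fiber.
rewrite !big_ord_recl big_ord0 mulr1 !(coefM, big_ord_recl, big_ord0) /=.
by rewrite !coef_inversion_poly ?(addnC 1%N) ?add0n ?card_intpartn0 ?card_intpartn1
   ?c1 ?cL // -ltnS.
Qed.

Lemma card_fiber_3_1 L (c : {ffun 'I_3 -> 'I_L.+1}) :
  (forall r, 1 <= c r)%N -> (forall r, c r + 1 <= L)%N -> #|fiber 1 c| = 3%N.
Proof.
move=> c1 cL; apply/eqP; rewrite -(eqr_nat int) card_fiber.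
rewrite !big_ord_recl big_ord0 mulr1 !(coefM, big_ord_recl, big_ord0) /=.
by rewrite !coef_inversion_poly ?(addnC 1%N) ?add0n ?card_intpartn0 ?card_intpartn1
   ?c1 ?cL // -ltnS.
Qed.

(** The coefficient of X^2 in (1 + X + 2 X^2)^3 is 3 * 2 + 3 = 9. *)
Lemma card_fiber_3_2 L (c : {ffun 'I_3 -> 'I_L.+1}) :
  (forall r, 2 <= c r)%N -> (forall r, c r + 2 <= L)%N -> #|fiber 2 c| = 9%N.
Proof.
move=> c1 cL; apply/eqP; rewrite -(eqr_nat int) card_fiber.
rewrite !big_ord_recl big_ord0 mulr1 !(coefM, big_ord_recl, big_ord0) /=.
have c2 r : (1 <= c r)%N by apply: leq_trans (c1 r).
have cL1 r : (c r + 1 <= L)%N by apply: leq_trans (cL r); rewrite leq_add2l.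
by rewrite !coef_inversion_poly ?(addnC 1%N) ?(addnC 2%N) ?add0n ?card_intpartn0
   ?card_intpartn1 ?card_intpartn2 ?c1 ?cL ?c2 ?cL1 // -ltnS.
Qed.

End Fibers.

(** * Eisenstein integers *)

Local Open Scope ring_scope.

(* The pair (x, y) stands for x + y e, where e is a primitive sixth root of
   unity: e ^ 2 = e - 1. *)
Definition enorm (z : int * int) : int := z.1 ^+ 2 + z.1 * z.2 + z.2 ^+ 2.
Definition emul (z w : int * int) : int * int :=
  (z.1 * w.1 - z.2 * w.2, z.1 * w.2 + z.2 * w.1 + z.2 * w.2).
(** Conjugation sends [e] to [1 - e]. *)
Definition econj (z : int * int) : int * int := (z.1 + z.2, - z.2).
(** Exactly one of the six associates of an element of norm prime to 3 is primary. *)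
Definition primary (z : int * int) : bool :=
  ((z.1 %% 3)%Z == 1) && ((z.2 %% 3)%Z == 0).

Lemma primaryP z : reflect (exists a b, z = (3 * a + 1, 3 * b)) (primary z).
Proof.
apply: (iffP andP) => [[/eqP z1 /eqP z2]|[a [b ->]] /=]; last by split; apply/eqP; lia.
by exists (z.1 %/ 3)%Z, (z.2 %/ 3)%Z; case: z z1 z2 => /= x y xE yE; congr pair; lia.
Qed.

Lemma enormM z w : enorm (emul z w) = enorm z * enorm w.
Proof. by rewrite /enorm /=; ring. Qed.

Lemma enorm_conj z : enorm (econj z) = enorm z.
Proof. by rewrite /enorm /=; ring. Qed.

Lemma primary_mul z w : primary z -> primary w -> primary (emul z w).
Proof.
move=> /primaryP[a [b ->]] /primaryP[c [d ->]]; apply/primaryP.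
exists (3 * a * c + a + c - 3 * b * d), (3 * a * d + d + 3 * b * c + b + 3 * b * d).
by rewrite /emul /=; congr pair; ring.
Qed.

Lemma primary_conj z : primary z -> primary (econj z).
Proof.
move=> /primaryP[a [b ->]]; apply/primaryP; exists (a + b), (- b).
by rewrite /econj /=; congr pair; ring.
Qed.

Lemma emulC : commutative emul.
Proof. by move=> [a b] [c d]; rewrite /emul /=; congr pair; ring. Qed.

Lemma emulA : associative emul.
Proof. by move=> [a b] [c d] [e f]; rewrite /emul /=; congr pair; ring. Qed.

Lemma emul_conj z : emul z (econj z) = (enorm z, 0).
Proof. by rewrite /emul /enorm /=; congr pair; ring. Qed.

Lemma emul_scalar x z : emul (x, 0) z = (x * z.1, x * z.2).
Proof. by rewrite /emul /=; congr pair; ring. Qed.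

Lemma enorm_ge0 z : 0 <= enorm z.
Proof. by rewrite /enorm; nia. Qed.

Lemma enorm_eq0 z : enorm z = 0 -> z = (0, 0).
Proof. by case: z => x y; rewrite /enorm /= => h; congr pair; nia. Qed.

Lemma emulI w : enorm w != 0 -> injective (emul w).
Proof.
move=> w0 [a b] [c d] /(congr1 (emul (econj w))).
rewrite !emulA (emulC _ w) emul_conj !emul_scalar /= => -[].
by move=> /(mulfI w0) -> /(mulfI w0) ->.
Qed.

(** * Primary elements of given norm *)

Lemma prime_dvdzM p x y : prime p -> (p%:Z %| x * y)%Z = (p%:Z %| x)%Z || (p%:Z %| y)%Z.
Proof. by move=> pp; rewrite !dvdzE abszM Euclid_dvdM. Qed.

Definition int_square (m : nat) : seq (int * int) :=
  [seq (i%:Z - m%:Z, j%:Z - m%:Z) | i <- iota 0 m.*2.+1, j <- iota 0 m.*2.+1].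

Definition primaries (m : nat) : {fset int * int} :=
  [fset z in int_square m | (enorm z == m%:Z) && primary z]%fset.

Lemma mem_int_square m z : `|z.1| <= m%:Z -> `|z.2| <= m%:Z -> z \in int_square m.
Proof.
case: z => x y /= xm ym; apply/allpairsP.
exists (`|(x + m%:Z)%R|%N, `|(y + m%:Z)%R|%N).
split; rewrite ?mem_iota /= ?add0n; [lia|lia|].
by congr pair; lia.
Qed.

(** The norm is positive definite: [3 * z.1 ^+ 2] and [3 * z.2 ^+ 2] are at most [4 * m], so
    [int_square m] misses no solution. *)
Lemma mem_primaries m z : (z \in primaries m) = (enorm z == m%:Z) && primary z.
Proof.
rewrite in_fset inE andb_idl // => /andP[/eqP zm _].
have abs_le (x : int) : 3 * x ^+ 2 <= 4 * m%:Z -> `|x| <= m by nia.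
apply: mem_int_square; apply: abs_le; rewrite -zm -subr_ge0.
  have -> : 4 * enorm z - 3 * z.1 ^+ 2 = (z.1 + 2 * z.2) ^+ 2 by rewrite /enorm; ring.
  exact: sqr_ge0.
have -> : 4 * enorm z - 3 * z.2 ^+ 2 = (z.2 + 2 * z.1) ^+ 2 by rewrite /enorm; ring.
exact: sqr_ge0.
Qed.

Lemma enorm_modp_root p (t : nat) (a b : int) : (p%:Z %| t%:Z ^+ 2 + t%:Z + 1)%Z ->
  (p%:Z %| a - t%:Z * b)%Z -> (p%:Z %| enorm (a, b))%Z.
Proof.
move=> /dvdzP[u ut] /dvdzP[v ab].
have {ab} -> : a = v * p%:Z + t%:Z * b by rewrite -ab; ring.
rewrite /enorm /=.
have -> : (v * p%:Z + t%:Z * b) ^+ 2 + (v * p%:Z + t%:Z * b) * b + b ^+ 2 =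
  (v ^+ 2 * p%:Z + 2 * v * t%:Z * b + v * b) * p%:Z + b ^+ 2 * (t%:Z ^+ 2 + t%:Z + 1) by ring.
by rewrite ut mulrA -mulrDl dvdz_mull.
Qed.

(** * Splitting of rational primes *)

Lemma dvdn_natr_Fp p n : prime p -> (p %| n)%N = (n%:R == 0 :> 'F_p).
Proof. by move=> pp; rewrite (dvdn_pcharf (pchar_Fp pp)). Qed.

Lemma dvdz_intr_Fp p (x : int) : prime p -> (p%:Z %| x)%Z = (x%:~R == 0 :> 'F_p).
Proof.
move=> pp; rewrite dvdzE /= dvdn_natr_Fp //.
by case: x => n //=; rewrite NegzE mulrNz oppr_eq0 -pmulrn.
Qed.

(** As 3 divides [p - 1], Cauchy's theorem gives a unit of order 3 modulo [p], a root of (u^3 - 1) /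
    (u - 1). *)
Lemma exists_cube_root p : prime p -> (p %% 3 = 1)%N ->
  exists t : nat, (p%:Z %| t%:Z ^+ 2 + t%:Z + 1)%Z.
Proof.
move=> pp p3.
have [u uE u3] : exists2 u : 'F_p, u ^+ 3 = 1 & u != 1.
  have : (3 %| #|[set: {unit 'F_p}]|)%N by rewrite card_finField_unit card_Fp //; lia.
  case/(Cauchy (isT : prime 3)) => v _ v3; exists (val v).
    by rewrite -FinRing.val_unitX -v3 expg_order.
  apply/eqP => v1; have : v = 1%g by apply: val_inj.
  by move/eqP; rewrite -order_eq1 v3.
exists (nat_of_ord u); rewrite dvdz_intr_Fp // !rmorphD rmorphXn /= -pmulrn natr_Zp.
have : (u - 1) * (u ^+ 2 + u + 1) = 0 by rewrite -[RHS](subrr 1) -{3}uE; ring.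
by move/eqP; rewrite mulf_eq0 subr_eq0 (negPf u3).
Qed.

Lemma nat_sqrt n : exists s : nat, (s * s <= n < s.+1 * s.+1)%N.
Proof.
elim: n => [|n [s sn]]; first by exists 0%N.
by have [/eqP e|ne] := boolP (n.+1 == s.+1 * s.+1)%N; [exists s.+1|exists s]; lia.
Qed.

Lemma thue p (t : nat) : prime p -> exists a b : int,
  [/\ (a, b) != (0, 0), a ^+ 2 < p%:Z, b ^+ 2 < p%:Z & (p%:Z %| a - t%:Z * b)%Z].
Proof.
move=> pp; have [s /andP[s1 s2]] := nat_sqrt p.
have sp : (s * s < p)%N.
  rewrite ltn_neqAle s1 andbT; apply/eqP => sE.
  have := dvdn_mulr s (dvdnn s); rewrite sE => /(primeP pp).2 /orP[] /eqP s'.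
    by move: pp; rewrite -sE s'.
  by have := prime_gt1 pp; nia.
(* Pigeonhole on the values of x1 - t x2 for 0 <= x1, x2 <= s, where s ^ 2 < p < (s + 1) ^ 2. *)
pose f (x : 'I_s.+1 * 'I_s.+1) : 'F_p := x.1%:R - t%:R * x.2%:R.
have /injectivePn[[x1 x2] [[y1 y2] xy]] : ~~ injectiveb f.
  apply/injectiveP => /leq_card; rewrite card_prod !card_ord Fp_cast //; lia.
rewrite /f /= => fxy; exists (x1%:Z - y1%:Z), (x2%:Z - y2%:Z).
split.
- apply: contraNneq xy => -[e1 e2]; rewrite xpair_eqE -!val_eqE /=; lia.
- have := ltn_ord x1; have := ltn_ord y1; nia.
- have := ltn_ord x2; have := ltn_ord y2; nia.
rewrite dvdz_intr_Fp // !(rmorphB, rmorphM) /= -!pmulrn -(subrr (x1%:R - t%:R * x2%:R)).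
by rewrite {2}fxy; apply/eqP; ring.
Qed.

(** The norm is (x - y)^2 modulo 3, which excludes x = y modulo 3; in each of the six other residue
    classes the witness is the product of [z] by a power of [e]. *)
Lemma associate_primary z : (enorm z %% 3)%Z = 1 ->
  exists2 w, enorm w = enorm z & primary w.
Proof.
case: z => x y; rewrite /enorm /primary /= => z3.
have res (a : int) : [\/ exists k, a = 3 * k, exists k, a = 3 * k + 1 | exists k, a = 3 * k + 2].
  have : (a %% 3)%Z = 0 \/ (a %% 3)%Z = 1 \/ (a %% 3)%Z = 2 by lia.
  by case=> [|[]] e; [constructor 1|constructor 2|constructor 3]; exists (a %/ 3)%Z; lia.
have nz k a : a = 3 * k -> (a %% 3)%Z = 1 -> False by lia.
case: (res x) (res y) => -[a xE] [] [b yE].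
- exfalso; apply: (nz _ _ _ z3); rewrite xE yE.
  by instantiate (1 := 3 * a ^+ 2 + 3 * a * b + 3 * b ^+ 2); ring.
- by exists (x + y, - x) => /=; [ring|lia].
- by exists (- (x + y), x) => /=; [ring|lia].
- by exists (x, y) => //=; lia.
- exfalso; apply: (nz _ _ _ z3); rewrite xE yE.
  by instantiate (1 := 3 * a ^+ 2 + 3 * a * b + 3 * b ^+ 2 + 3 * a + 3 * b + 1); ring.
- by exists (- y, x + y) => /=; [ring|lia].
- by exists (- x, - y) => /=; [ring|lia].
- by exists (y, - (x + y)) => /=; [ring|lia].
exfalso; apply: (nz _ _ _ z3); rewrite xE yE.
by instantiate (1 := 3 * a ^+ 2 + 3 * a * b + 3 * b ^+ 2 + 6 * a + 6 * b + 4); ring.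
Qed.

Lemma inert_dvd_enorm p x y : prime p -> (p %% 3 = 2)%N ->
  (p%:Z %| enorm (x, y))%Z -> (p%:Z %| x)%Z /\ (p%:Z %| y)%Z.
Proof.
move=> pp p3; rewrite !dvdz_intr_Fp // /enorm /= !rmorphD rmorphM !rmorphXn /=.
set a := x%:~R; set b := y%:~R => /eqP ab.
(* a ^ 3 = b ^ 3 and a ^ (p - 1) = b ^ (p - 1) force a = b, since p - 1 is 1 mod 3. *)
have a3 : a ^+ 3 = b ^+ 3.
  apply/eqP; rewrite -subr_eq0; apply/eqP.
  by transitivity ((a - b) * (a ^+ 2 + a * b + b ^+ 2)); [ring|rewrite ab mulr0].
have b0 : b = 0 -> a = 0.
  move=> b0; move: a3; rewrite b0 expr0n /= => /eqP.
  by rewrite expf_eq0 /= => /eqP.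
suff bz : b = 0 by rewrite (b0 bz) bz eqxx.
apply/eqP; apply: contraT => bn0.
have an0 : a != 0.
  by apply: contra bn0 => /eqP a0; move: a3; rewrite a0 expr0n /= => /esym/eqP; rewrite expf_eq0.
have fl (c : 'F_p) : c != 0 -> c ^+ p.-1 = 1.
  move=> c0; apply: (mulfI c0); rewrite -exprS prednK ?prime_gt0 // mulr1.
  by rewrite -{2}(expf_card c) card_Fp.
have e : (p.-1 = 3 * (p %/ 3) + 1)%N by lia.
have eab : a = b.
  apply: (@mulfI _ (a ^+ (3 * (p %/ 3)))); first by rewrite expf_neq0.
  rewrite -exprSr -addn1 -e fl // {1}exprM a3 -exprM -exprSr -addn1 -e fl //.
(* Now the norm is [3 * b ^+ 2], nonzero since [p] is not 3. *)
move: ab; rewrite eab => /eqP; have -> : b ^+ 2 + b * b + b ^+ 2 = 3%:R * b ^+ 2 by ring.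
rewrite mulf_eq0 expf_eq0 /= (negPf bn0) orbF -dvdn_natr_Fp //.
by rewrite dvdn_prime2 // => /eqP p3'; rewrite p3' in p3.
Qed.

(** Thue's lemma at a root of t^2 + t + 1 gives a norm [k * p] with 0 < k < 3. Since 2 is inert, k =
    2 would make both coordinates even and then [p] even. *)
Lemma prime_split p : prime p -> (p %% 3 = 1)%N -> exists2 w, enorm w = p%:Z & primary w.
Proof.
move=> pp p3; have [t tp] := exists_cube_root pp p3.
have [a [b [ab0 ap bp pab]]] := thue t pp.
have /dvdzP[k kp] := enorm_modp_root tp pab.
have k0 : 0 < k.
  have := enorm_ge0 (a, b); rewrite kp.
  have : enorm (a, b) != 0 by apply: contra ab0 => /eqP/enorm_eq0 ->.
  by rewrite kp; have := prime_gt0 pp; nia.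
have k3 : k < 3.
  have : enorm (a, b) < 3 * p%:Z by rewrite /enorm /=; nia.
  by rewrite kp; nia.
have k1 : k = 1.
  have [//|k2] : k = 1 \/ k = 2 by move: k0 k3; lia.
  have d2 : (2%:Z %| enorm (a, b))%Z by rewrite kp k2 dvdz_mulr.
  case: (@inert_dvd_enorm 2 a b isT erefl d2) kp => /dvdzP[x ->] /dvdzP[y ->].
  rewrite k2 => /(congr1 (fun x => (x %/ 2)%Z)); rewrite mulKz //.
  have -> : enorm (x * 2, y * 2) = 2 * (2 * (x ^+ 2 + x * y + y ^+ 2)) by rewrite /enorm /=; ring.
  rewrite mulKz // => pE; have : (2%:Z %| p%:Z)%Z by rewrite -pE dvdz_mulr.
  by rewrite dvdzE /= dvdn_prime2 // => /eqP p2; rewrite -p2 in p3.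
have [|w wE wp] := @associate_primary (a, b); first by rewrite kp k1 mul1r; lia.
by exists w => //; rewrite wE kp k1 mul1r.
Qed.

Lemma card_primaries_inert p m : prime p -> (p %% 3 = 2)%N -> (0 < m)%N ->
  #|` primaries (p * m)| = if (p %| m)%N then #|` primaries (m %/ p)| else 0%N.
Proof.
move=> pp p3 m0.
have p0 : p%:Z != 0 by have := prime_gt0 pp; lia.
(* The sign makes the multiplier primary, [p] being 2 modulo 3. *)
pose g z := emul (- p%:Z, 0) z.
have gI : injective g by apply: emulI; rewrite /enorm /=; nia.
have gprim z : primary (g z) = primary z.
  by rewrite /g emul_scalar /primary /=; case: z => x y /=; nia.
have sub z : z \in primaries (p * m) -> exists2 w, z = g w & primary w && (p%:Z * enorm w == m%:Z).
  rewrite mem_primaries => /andP[/eqP zE zp].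
  have : (p%:Z %| enorm z)%Z by rewrite zE PoszM dvdz_mulr.
  case: z zE zp => x y zE zp /(inert_dvd_enorm pp p3)[/dvdzP[a aE] /dvdzP[b bE]].
  have zg : (x, y) = g (- a, - b) by rewrite /g emul_scalar aE bE /=; congr pair; ring.
  exists (- a, - b) => //; rewrite -gprim -zg zp /=.
  apply/eqP/(mulfI p0); rewrite -PoszM -zE zg enormM.
  by rewrite /enorm /=; ring.
case: ifP => [/dvdnP[q mE]|pm].
  rewrite mE mulnK ?prime_gt0 //.
  have -> : primaries (p * (q * p)) = (g @` primaries q)%fset.
    apply/fsetP => z; apply/idP/imfsetP => [|[w]].
      rewrite -mE => /sub[w ->] /andP[wp /eqP wE]; exists w => //=.
      by rewrite mem_primaries wp andbT; apply/eqP/(mulfI p0); rewrite wE mE PoszM mulrC.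
    rewrite /= !mem_primaries => /andP[/eqP wE wp] ->; rewrite gprim wp andbT enormM wE.
    by apply/eqP; rewrite /enorm /= !PoszM; ring.
  by rewrite card_imfset.
apply/eqP; rewrite cardfs_eq0; apply/eqP/fsetP => z; rewrite in_fset0; apply/negP.
move=> /sub[w _ /andP[_ /eqP wE]]; move: pm.
by rewrite -[(p %| m)%N]/(p%:Z %| m%:Z)%Z -wE dvdz_mulr.
Qed.

(* With p = w w', w' conjugate to w: the elements of norm p m are the multiples
   of w and those of w', and the common multiples are the multiples of p. *)
Lemma card_primaries_split p m : prime p -> (p %% 3 = 1)%N -> (0 < m)%N ->
  (#|` primaries (p * m)| + (if (p %| m)%N then #|` primaries (m %/ p)| else 0) =
   #|` primaries m| + #|` primaries m|)%N.
Proof.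
move=> pp p3 m0; have [w wE wp] := prime_split pp p3.
have p0 : p%:Z != 0 by have := prime_gt0 pp; lia.
have w0 : enorm w != 0 by rewrite wE.
have w0' : enorm (econj w) != 0 by rewrite enorm_conj wE.
have cw : emul (econj w) w = (p%:Z, 0) by rewrite emulC emul_conj wE.
have sub z : z \in primaries m -> forall v, primary v -> enorm v = p%:Z ->
    emul v z \in primaries (p * m).
  rewrite mem_primaries => /andP[/eqP zE zp] v vp vE.
  by rewrite mem_primaries primary_mul // enormM zE vE PoszM eqxx.
(* Division by [v] amounts to division of [econj v] times [z] by [p]. If [p] divides the second
   coordinate, it divides the first too, since the norm of that product is divisible by [p]. *)
have quo v z : primary v -> enorm v = p%:Z -> z \in primaries (p * m) ->
    (p%:Z %| (emul (econj v) z).2)%Z -> exists2 z', z' \in primaries m & z = emul v z'.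
  move=> vp vE; rewrite mem_primaries => /andP[/eqP zE zp].
  have nE : enorm (emul (econj v) z) = p%:Z * p%:Z * m%:Z.
    by rewrite enormM enorm_conj vE zE PoszM mulrA.
  have pr : primary (emul (econj v) z) by rewrite primary_mul ?primary_conj.
  case eE : (emul (econj v) z) => [x y] /= py; rewrite eE in nE pr.
  have px : (p%:Z %| x)%Z.
    have : (p%:Z %| x * x)%Z.
      have -> : x * x = p%:Z * p%:Z * m%:Z - (x + y) * y by rewrite -nE /enorm /=; ring.
      by apply: rpredB; [rewrite -mulrA dvdz_mulr|rewrite dvdz_mull].
    by rewrite prime_dvdzM // orbb.
  case/dvdzP: px py => a aE /dvdzP[b bE].
  exists (a, b).
    rewrite mem_primaries; apply/andP; split.
      apply/eqP/(mulfI p0)/(mulfI p0); rewrite [RHS]mulrA -nE aE bE /enorm /=; ring.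
    by move: pr; rewrite aE bE /primary /=; nia.
  apply: (@emulI (econj v)); first by rewrite enorm_conj vE.
  by rewrite emulA (emulC _ v) emul_conj emul_scalar vE eE aE bE /= ![p%:Z * _]mulrC.
have cup : primaries (p * m) =
    ((emul w @` primaries m) `|` (emul (econj w) @` primaries m))%fset.
  apply/fsetP => z; rewrite in_fsetU; apply/idP/orP => [zP|]; last first.
    case=> /imfsetP[z' z'P ->]; apply: sub => //; first exact: primary_conj.
    by rewrite enorm_conj.
  (* As [p] divides both norms, it divides one of these two factors, so [quo] applies to [w] or to
     its conjugate. *)
  have : (p%:Z %| (emul (econj w) z).2 * (emul w z).2)%Z.
    have -> : (emul (econj w) z).2 * (emul w z).2 =
       z.2 ^+ 2 * enorm w - w.2 ^+ 2 * enorm z by rewrite /enorm /=; ring.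
    move: (zP); rewrite mem_primaries wE => /andP[/eqP -> _].
    by rewrite PoszM; apply: rpredB; [rewrite dvdz_mull|rewrite mulrCA dvdz_mulr].
  rewrite prime_dvdzM // => /orP[] h; [left|right]; apply/imfsetP.
    by case: (quo w z wp wE zP h) => z' ? ?; exists z'.
  have wcc : econj (econj w) = w by case: (w) => a b; rewrite /econj /=; congr pair; ring.
  rewrite -{1}wcc in h.
  case: (quo (econj w) z _ _ zP h) => [||z' ? ?]; rewrite ?primary_conj ?enorm_conj //.
  by exists z'.
have cap : #|` ((emul w @` primaries m) `&` (emul (econj w) @` primaries m))%fset| =
    if (p %| m)%N then #|` primaries (m %/ p)| else 0%N.
  have key z : z \in primaries m -> forall z', z' \in primaries m ->
      emul w z = emul (econj w) z' -> exists2 u, emul w z = emul (p%:Z, 0) u & 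
        primary u && (p%:Z * enorm u == m%:Z).
    rewrite mem_primaries => /andP[/eqP zE zp] z' _ zz'.
    have e1 : emul (econj w) (emul w z) = (p%:Z * z.1, p%:Z * z.2).
      by rewrite emulA cw emul_scalar.
    have e2 : emul w (emul w z) = (p%:Z * z'.1, p%:Z * z'.2).
      by rewrite zz' emulA emul_conj wE emul_scalar.
    have prim : primary (emul w z) by apply: primary_mul.
    have nm : enorm (emul w z) = p%:Z * m%:Z by rewrite enormM wE zE.
    move: (emul w z) e1 e2 prim nm => [x y] e1 e2 prim nm.
    (* This is the trace of [w]. If [p] divided it, [p] would divide [w.2] and then [w.1], so its
       square would divide the norm [p]. *)
    have nd : ~~ (p%:Z %| 2 * w.1 + w.2)%Z.
      apply/negP => d1.
      have pn2 : ~~ (p%:Z %| 2)%Z.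
        rewrite dvdzE /= dvdn_prime2 //; apply/eqP => pE; by rewrite pE in p3.
      have pn3 : ~~ (p%:Z %| 3)%Z.
        rewrite dvdzE /= dvdn_prime2 //; apply/eqP => pE; by rewrite pE in p3.
      have d2 : (p%:Z %| w.2)%Z.
        have : (p%:Z %| 3 * (w.2 * w.2))%Z.
          have -> : 3 * (w.2 * w.2) = 4 * enorm w - (2 * w.1 + w.2) * (2 * w.1 + w.2).
            by rewrite /enorm; ring.
          by rewrite wE rpredB ?dvdz_mull.
        by rewrite !prime_dvdzM // (negPf pn3) orbb.
      have d3 : (p%:Z %| w.1)%Z.
        have : (p%:Z %| 2 * w.1)%Z.
          have -> : 2 * w.1 = (2 * w.1 + w.2) - w.2 by ring.
          by rewrite rpredB.
        by rewrite prime_dvdzM // (negPf pn2).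
      case/dvdzP: d2 d3 => b bE /dvdzP[a aE]; move: wE; rewrite /enorm aE bE.
      have -> : (a * p%:Z) ^+ 2 + a * p%:Z * (b * p%:Z) + (b * p%:Z) ^+ 2
        = p%:Z * (p%:Z * (a ^+ 2 + a * b + b ^+ 2)) by ring.
      rewrite -[RHS]mulr1 => /(mulfI p0) /(congr1 absz); rewrite abszM /= => /eqP.
      rewrite muln_eq1 => /andP[/eqP p1 _]; by rewrite p1 in pp.
    (* Adding [e1] and [e2] multiplies (x, y) by the trace of [w]. *)
    have [dx dy] : (p%:Z %| x)%Z /\ (p%:Z %| y)%Z.
      case: e1 => /= a1 b1; case: e2 => /= a2 b2.
      have: (p%:Z %| (2 * w.1 + w.2) * x)%Z.
        have -> : (2 * w.1 + w.2) * x = p%:Z * z.1 + p%:Z * z'.1 by rewrite -a1 -a2; ring.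
        by rewrite rpredD ?dvdz_mulr.
      have: (p%:Z %| (2 * w.1 + w.2) * y)%Z.
        have -> : (2 * w.1 + w.2) * y = p%:Z * z.2 + p%:Z * z'.2 by rewrite -b1 -b2; ring.
        by rewrite rpredD ?dvdz_mulr.
      by rewrite !prime_dvdzM // !(negPf nd).
    case/dvdzP: dx dy nm prim => a -> /dvdzP[b ->] nm prim.
    exists (a, b); first by rewrite emul_scalar /= ![p%:Z * _]mulrC.
    apply/andP; split; first by move: prim; rewrite /primary /=; nia.
    by apply/eqP/(mulfI p0); rewrite -nm /enorm /=; ring.
  case: ifP => [/dvdnP[q mE]|pm]; last first.
    apply/eqP; rewrite cardfs_eq0; apply/eqP/fsetP => z; rewrite in_fset0.
    apply/negP; rewrite in_fsetI => /andP[/imfsetP[a aP ->] /imfsetP[b bP ab]].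
    case: (key a aP b bP ab) => u _ /andP[_ /eqP uE]; move: pm.
    by rewrite -[(p %| m)%N]/(p%:Z %| m%:Z)%Z -uE dvdz_mulr.
  rewrite mE mulnK ?prime_gt0 // -mE.
  have -> : ((emul w @` primaries m) `&` (emul (econj w) @` primaries m))%fset =
     (emul (p%:Z, 0) @` primaries q)%fset.
    apply/fsetP => z; rewrite in_fsetI; apply/andP/imfsetP => [|[u uP ->]].
      case=> /imfsetP[a aP ->] /imfsetP[b bP ab].
      case: (key a aP b bP ab) => u -> /andP[up /eqP uE]; exists u => //=.
      rewrite mem_primaries up andbT; apply/eqP/(mulfI p0).
      by rewrite uE mE PoszM mulrC.
    have vP v : primary v -> enorm v = p%:Z -> emul v u \in primaries m.
      move=> vp vE; move: uP; rewrite /= !mem_primaries => /andP[/eqP uE up].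
      by rewrite enormM uE vE mE PoszM mulrC eqxx primary_mul.
    split; apply/imfsetP.
      exists (emul (econj w) u); last by rewrite emulA emul_conj wE.
      by apply: vP; rewrite ?primary_conj ?enorm_conj.
    by exists (emul w u); [apply: vP|rewrite emulA cw].
  rewrite card_imfset //; apply: emulI; rewrite /enorm /=; nia.
by rewrite -cap {1}cup cardfsUI !card_imfset //; apply: emulI.
Qed.

(** * Divisor sums of the character modulo 3 *)

Lemma legendre3E (d : nat) :
  legendre d%:Z 3 = if (d %% 3 == 0)%N then 0 else if (d %% 3 == 1)%N then 1 else -1.
Proof.
rewrite /legendre dvdzE /= /dvdn; case: eqP => // d0.
case: ifP => [/existsP[x]|/existsP ex].
  have : (x < 3)%N by []. 
  by case: x => [[|[|[|x]]] //= ltx] _ /eqP e; case: eqP => //; lia.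
case: eqP => // d1; case: ex; exists (Ordinal (isT : (1 < 3)%N)).
by apply/eqP => /=; lia.
Qed.

Lemma legendre3M (a b : nat) : legendre (a * b)%N%:Z 3 = legendre a%:Z 3 * legendre b%:Z 3.
Proof.
rewrite !legendre3E -modnMm.
have : (a %% 3 < 3)%N by rewrite ltn_mod.
have : (b %% 3 < 3)%N by rewrite ltn_mod.
by case: (a %% 3)%N => [|[|[|?]]] //; case: (b %% 3)%N => [|[|[|?]]].
Qed.

Lemma sum_divisors_multiples (F : nat -> int) p m : (0 < p)%N -> (0 < m)%N ->
  \sum_(d <- divisors (p * m) | (p %| d)%N) F d = \sum_(d <- divisors m) F (p * d)%N.
Proof.
move=> p0 m0; rewrite -big_filter -(big_map (muln p) predT F); apply: perm_big.
apply: uniq_perm => [||d].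
- by rewrite filter_uniq // divisors_uniq.
- by rewrite map_inj_uniq ?divisors_uniq // => a b /eqP; rewrite eqn_pmul2l // => /eqP.
rewrite mem_filter -dvdn_divisors ?muln_gt0 ?p0 //.
apply/andP/mapP => [[/dvdnP[e ->]]|[e]].
  rewrite mulnC dvdn_pmul2l // => em; exists e; rewrite // -dvdn_divisors //.
by rewrite -dvdn_divisors // => em ->; rewrite dvdn_mulr // dvdn_pmul2l.
Qed.

(** Divisors of [p * m] divisible by [p] are [p] times the divisors of [m]; those prime to [p] are
    the divisors of [m] less the multiples of [p] among them. *)
Lemma sum_legendre3_divisors_prime p m : prime p -> (0 < m)%N ->
  \sum_(d <- divisors (p * m)) legendre d%:Z 3 =
  (1 + legendre p%:Z 3) * \sum_(d <- divisors m) legendre d%:Z 3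
  - legendre p%:Z 3 *
    (if (p %| m)%N then \sum_(d <- divisors (m %/ p)) legendre d%:Z 3 else 0).
Proof.
move=> pp m0; have p0 := prime_gt0 pp.
pose chi d := legendre (d : nat)%:Z 3.
have mulE n : \sum_(d <- divisors n) chi (p * d)%N = chi p * \sum_(d <- divisors n) chi d.
  by rewrite mulr_sumr; apply: eq_bigr => d _; rewrite /chi legendre3M.
have coE : \sum_(d <- divisors (p * m) | ~~ (p %| d)%N) chi d =
    \sum_(d <- divisors m | ~~ (p %| d)%N) chi d.
  rewrite -big_filter -[RHS]big_filter; apply: perm_big; apply: uniq_perm => [||d].
  - by rewrite filter_uniq // divisors_uniq.
  - by rewrite filter_uniq // divisors_uniq.
  rewrite !mem_filter -!dvdn_divisors ?muln_gt0 ?p0 //; case: (boolP (p %| d)%N) => //= pd.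
  by rewrite Gauss_dvdr // coprime_sym prime_coprime.
have pE : \sum_(d <- divisors m | (p %| d)%N) chi d =
    chi p * (if (p %| m)%N then \sum_(d <- divisors (m %/ p)) chi d else 0).
  case: ifP => [/dvdnP[q mE]|pm].
    have q0 : (0 < q)%N by move: m0; rewrite mE muln_gt0 => /andP[].
    by rewrite mE mulnK // mulnC sum_divisors_multiples // mulE.
  rewrite mulr0 big1_seq // => d /andP[pd]; rewrite -dvdn_divisors // => dm.
  by rewrite (dvdn_trans pd dm) in pm.
have split n : \sum_(d <- divisors n) chi d = \sum_(d <- divisors n | (p %| d)%N) chi d +
    \sum_(d <- divisors n | ~~ (p %| d)%N) chi d by rewrite (bigID (fun d => p %| d)%N).
rewrite -[LHS]/(\sum_(d <- divisors (p * m)) chi d) split sum_divisors_multiples // mulE coE.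
have -> : \sum_(d <- divisors m | ~~ (p %| d)%N) chi d =
   \sum_(d <- divisors m) chi d - \sum_(d <- divisors m | (p %| d)%N) chi d.
  by rewrite [X in _ = X - _]split; ring.
by rewrite pE -/(chi p); ring.
Qed.

Lemma primaries1 : primaries 1 = [fset (1, 0)]%fset.
Proof.
apply/fsetP => z; rewrite mem_primaries in_fset1; apply/andP/eqP => [|->] //.
move=> [/eqP zE /primaryP[a [b zab]]]; move: zE; rewrite zab /enorm /= => e.
have b0 : b = 0.
  have := sqr_ge0 (2 * (3 * a + 1) + 3 * b).
  have -> : (2 * (3 * a + 1) + 3 * b) ^+ 2 = 4 * 1%:Z - 27 * b ^+ 2 by rewrite -e; ring.
  by nia.
by move: e; rewrite b0 => e; congr pair; nia.
Qed.

(** Both sides are 1 at [m = 1] and satisfy the same Hecke relation at the least prime factor of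
    [m], which is not 3; strong induction concludes. *)
Lemma card_primaries m : (0 < m)%N -> ~~ (3 %| m)%N ->
  (#|` primaries m|)%:Z = \sum_(d <- divisors m) legendre d%:Z 3.
Proof.
elim/ltn_ind: m => m IH m0 m3.
have [m1|m1] := leqP m 1.
  have -> : m = 1%N by lia.
  by rewrite primaries1 cardfs1 (_ : divisors 1 = [:: 1%N]) // big_seq1 legendre3E.
have pp := pdiv_prime m1; set p := pdiv m in pp.
have /dvdnP[q mE] : (p %| m)%N := pdiv_dvd m.
have q0 : (0 < q)%N by move: m0; rewrite mE muln_gt0 => /andP[].
have qm : (q < m)%N by rewrite mE ltn_Pmulr // prime_gt1.
have q3 : ~~ (3 %| q)%N by apply: contra m3 => h; rewrite mE dvdn_mulr.
have p3 : ~~ (3 %| p)%N by apply: contra m3 => h; rewrite mE dvdn_mull.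
have IHq := IH q qm q0 q3.
have IHpq : (p %| q)%N -> (#|` primaries (q %/ p)|)%:Z =
    \sum_(d <- divisors (q %/ p)) legendre d%:Z 3.
  case/dvdnP => r qE; have r0 : (0 < r)%N by move: q0; rewrite qE muln_gt0 => /andP[].
  rewrite qE mulnK ?prime_gt0 //; apply: IH => //.
    by apply: leq_ltn_trans qm; rewrite qE leq_pmulr // prime_gt0.
  by apply: contra q3 => h; rewrite qE dvdn_mulr.
rewrite mE mulnC sum_legendre3_divisors_prime //.
have [p31|p32] : (p %% 3 = 1 \/ p %% 3 = 2)%N by lia.
  have /(congr1 (fun n => n%:Z)) := card_primaries_split pp p31 q0.
  rewrite legendre3E p31 /= -IHq !PoszD.
  by case: ifP => [/IHpq <-|_] e; [rewrite mulrDl mul1r -e|rewrite mulr0 -[LHS]addr0 e]; ring.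
rewrite card_primaries_inert // legendre3E p32 /=.
by case: ifP => [/IHpq <-|_]; ring.
Qed.

(** * Counting cores *)

Lemma ord2P (P : 'I_2 -> Prop) : P ord0 -> P (lift ord0 ord0) -> forall r, P r.
Proof. by move=> P0 P1 [[|[|r]] //= lt]; [move: P0|move: P1]; congr P; apply: val_inj. Qed.

Lemma ord3P (P : 'I_3 -> Prop) : P ord0 -> P (lift ord0 ord0) ->
  P (lift ord0 (lift ord0 ord0)) -> forall r, P r.
Proof.
by move=> P0 P1 P2 [[|[|[|r]]] //= lt]; [move: P0|move: P1|move: P2]; congr P; apply: val_inj.
Qed.

Lemma bin2z (x : nat) : 2 * ('C(x, 2))%:Z = x%:Z * (x%:Z - 1).
Proof. by elim: x => // x IHx; rewrite binS bin1 PoszD mulrDr IHx; lia. Qed.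

(** With [2 * K] letters true, a 2-core is given by its deviation [b] from the balanced occupation
    (K, K). *)
Lemma mem_occupations2 L K m (c : {ffun 'I_2 -> 'I_L.+1}) (x := c ord0) (y := c (lift ord0 ord0)) :
  c \in occupations 2 L (2 * K) m <->
  (exists b : int, [/\ x%:Z = K%:Z - b, y%:Z = K%:Z + b & m%:Z = b * (2 * b + 1)]).
Proof.
rewrite inE /core_size !big_ord_recl !big_ord0 /= /bump /= -/x -/y.
have bx := bin2z x; have by_ := bin2z y; have bK := bin2z (2 * K).
split=> [/andP[/eqP s /eqP e]|[b [xE yE mE]]].
  exists (y%:Z - K%:Z); have sx : x%:Z = 2 * K%:Z - y%:Z by lia.
  split; [lia|lia|].
  have e' : m%:Z + ('C(2 * K, 2))%:Z = 2 * ('C(x, 2))%:Z + 2 * ('C(y, 2))%:Z + y%:Z by lia.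
  apply: (@mulfI _ 2) => //; rewrite bx sx in e' * => {bx}.
  have -> : 2 * m%:Z = 2 * (m%:Z + ('C(2 * K, 2))%:Z) - 2 * ('C(2 * K, 2))%:Z by ring.
  by rewrite e' by_ bK PoszM; ring.
apply/andP; split; apply/eqP; first by lia.
suff : m%:Z + ('C(2 * K, 2))%:Z = 2 * ('C(x, 2))%:Z + 2 * ('C(y, 2))%:Z + y%:Z by lia.
apply: (@mulfI _ 2) => //; rewrite mulrDr bK bx by_ mE xE yE PoszM; ring.
Qed.

(** In the deviations from (K, K, K) the core size is 3 (a^2 + a b + b^2) - 2 a - b; tripling and
    adding 1 completes it to a norm. *)
Lemma mem_occupations3 L K m (c : {ffun 'I_3 -> 'I_L.+1}) (x := c ord0) (y := c (lift ord0 ord0))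
    (z := c (lift ord0 (lift ord0 ord0))) :
  c \in occupations 3 L (3 * K) m <->
  (exists a b : int, [/\ x%:Z = K%:Z + a, y%:Z = K%:Z + b, z%:Z = K%:Z - a - b
     & enorm (1 - 3 * a, - 3 * b) = (3 * m + 1)%N%:Z]).
Proof.
rewrite inE /core_size !big_ord_recl !big_ord0 /= /bump /= -/x -/y -/z.
have bx := bin2z x; have by_ := bin2z y; have bz := bin2z z; have bK := bin2z (3 * K).
rewrite !PoszM /enorm /= in bK *.
split=> [/andP[/eqP s /eqP e]|[a [b [xE yE zE mE]]]].
  exists (x%:Z - K%:Z), (y%:Z - K%:Z); have sz : z%:Z = 3 * K%:Z - x%:Z - y%:Z by lia.
  split; [lia|lia|lia|].
  have e' : m%:Z + ('C(3 * K, 2))%:Z =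
    3 * ('C(x, 2))%:Z + 3 * ('C(y, 2))%:Z + 3 * ('C(z, 2))%:Z + y%:Z + 2 * z%:Z by lia.
  apply: (@mulfI _ 2) => //; rewrite PoszD PoszM.
  have -> : 2 * (3 * m%:Z + 1) =
    3 * (2 * (m%:Z + ('C(3 * K, 2))%:Z) - 2 * ('C(3 * K, 2))%:Z) + 2 by ring.
  rewrite e' bK.
  have -> : 2 * (3 * ('C(x, 2))%:Z + 3 * ('C(y, 2))%:Z + 3 * ('C(z, 2))%:Z + y%:Z + 2 * z%:Z) =
   3 * (2 * ('C(x, 2))%:Z + 2 * ('C(y, 2))%:Z + 2 * ('C(z, 2))%:Z) + 2 * y%:Z + 4 * z%:Z by ring.
  by rewrite bx by_ bz sz; ring.
apply/andP; split; apply/eqP; first by lia.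
suff : m%:Z + ('C(3 * K, 2))%:Z =
    3 * ('C(x, 2))%:Z + 3 * ('C(y, 2))%:Z + 3 * ('C(z, 2))%:Z + y%:Z + 2 * z%:Z by lia.
(* The factor 2 clears the binomials and the factor 3 brings in [3 * m + 1]. *)
apply: (@mulfI _ 6) => //.
have -> : 6 * (m%:Z + ('C(3 * K, 2))%:Z) = 2 * (3 * m + 1)%N%:Z - 2 + 3 * (2 * ('C(3 * K, 2))%:Z).
  by rewrite PoszD PoszM; ring.
have -> : 6 * (3 * ('C(x, 2))%:Z + 3 * ('C(y, 2))%:Z + 3 * ('C(z, 2))%:Z + y%:Z + 2 * z%:Z) =
   9 * (2 * ('C(x, 2))%:Z + 2 * ('C(y, 2))%:Z + 2 * ('C(z, 2))%:Z) + 6 * y%:Z + 12 * z%:Z by ring.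
by rewrite bK -mE bx by_ bz xE yE zE; ring.
Qed.

Lemma occupations2_bound L m (c : {ffun 'I_2 -> 'I_L.+1}) :
  c \in occupations 2 L (2 * (m + 3)) m -> forall r, (1 <= c r)%N /\ (c r <= 2 * m + 5)%N.
Proof.
move=> /mem_occupations2[b [xE yE mE]].
have [b1 b2] : b <= m%:Z /\ - m%:Z <= b by split; nia.
by apply: ord2P; lia.
Qed.

(** The map b -> b (2 b + 1) is injective on the integers: a difference of two values is b - b'
    times an odd number. *)
Lemma occupations2_uniq L K m (c d : {ffun 'I_2 -> 'I_L.+1}) :
  c \in occupations 2 L (2 * K) m -> d \in occupations 2 L (2 * K) m -> c = d.
Proof.
move=> /mem_occupations2[b [xE yE mE]] /mem_occupations2[b' [xE' yE' mE']].
have bb : b = b'.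
  have : (b - b') * (2 * (b + b') + 1) = 0 by rewrite -(subrr m%:Z) {1}mE mE'; ring.
  by move/eqP; rewrite mulf_eq0 => /orP[] /eqP; lia.
by apply/ffunP; apply: ord2P; apply: val_inj => /=; lia.
Qed.

(** Even [t = 2 h] corresponds to [b = h], odd [t = 2 h + 1] to [b = - h - 1]. *)
Lemma triangular_pronic m t : m = (t * (t + 1) %/ 2)%N -> exists b : int, m%:Z = b * (2 * b + 1).
Proof.
move=> ->; have tE := odd_double_half t; move: (half t) (odd t) tE => h [] <-.
  exists (- h%:Z - 1); rewrite (_ : (_ * _)%N = ((2 * h + 1) * (h + 1) * 2)%N); last by lia.
  by rewrite mulnK //; lia.
exists h%:Z; rewrite (_ : (_ * _)%N = (h * (2 * h + 1) * 2)%N); last by lia.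
by rewrite mulnK //; lia.
Qed.

Lemma pronic_triangular m (b : int) : m%:Z = b * (2 * b + 1) ->
  exists t, m = (t * (t + 1) %/ 2)%N.
Proof.
case: b => h mE.
  exists (2 * h)%N; rewrite (_ : (_ * _)%N = (h * (2 * h + 1) * 2)%N); last by lia.
  by rewrite mulnK //; lia.
exists (2 * h + 1)%N; rewrite (_ : (_ * _)%N = ((2 * h + 1) * (h + 1) * 2)%N); last by lia.
by rewrite mulnK //; move: mE; rewrite NegzE; nia.
Qed.

Lemma card_occupations2 m t : m = (t * (t + 1) %/ 2)%N ->
  #|occupations 2 (2 * (m + 3)) (2 * (m + 3)) m| = 1%N.
Proof.
move=> /triangular_pronic[b bE].
have [b1 b2] : b <= m%:Z /\ - m%:Z <= b by split; nia.
pose c : {ffun 'I_2 -> 'I_(2 * (m + 3)).+1} :=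
  [ffun r : 'I_2 => inord (if r == ord0 then `|(m%:Z + 3 - b)%R|%N else `|(m%:Z + 3 + b)%R|%N)].
have cP : c \in occupations 2 (2 * (m + 3)) (2 * (m + 3)) m.
  by apply/mem_occupations2; exists b; split=> //; rewrite ffunE /= inordK; lia.
rewrite (_ : occupations _ _ _ _ = [set c]) ?cards1 //; apply/setP => d; rewrite in_set1.
by apply/idP/eqP => [dP|-> //]; apply: occupations2_uniq dP cP.
Qed.

(** Four times the norm is 3 a^2 plus a square for each of a = x, y, x + y. *)
Lemma enorm_bound (x y B : int) : 0 <= B -> 4 * enorm (x, y) < 3 * B ^+ 2 ->
  [/\ `|x| < B, `|y| < B & `|x + y| < B].
Proof.
rewrite /enorm /= => B0 h.
have sq (a c d : int) : 4 * (x ^+ 2 + x * y + y ^+ 2) = 3 * a ^+ 2 + c ^+ 2 -> `|a| < B.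
  move=> e; have := sqr_ge0 c; rewrite e in h => c0.
  rewrite -(@ltr_pXn2r _ 2) ?nnegrE // -normrX ger0_norm ?sqr_ge0 //; lia.
split; [apply: (sq _ (2 * y + x))|apply: (sq _ (2 * x + y))|apply: (sq _ (x - y))] => //; ring.
Qed.

Lemma occupations3_bound m (a b : int) : enorm (1 - 3 * a, - 3 * b) = (3 * m + 1)%N%:Z ->
  [/\ `|a| <= m%:Z + 1, `|b| <= m%:Z + 1 & `|a + b| <= m%:Z + 1].
Proof.
move=> e; have [||] := @enorm_bound (1 - 3 * a) (- 3 * b) (2 * m%:Z + 2); [lia| |].
  by rewrite e PoszD PoszM; nia.
have -> : 1 - 3 * a + - 3 * b = 1 - 3 * (a + b) by ring.
by move=> ba bb bab; split; lia.
Qed.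

(** Deviations of at most [m + 1] from [m + 3] leave two letters of each kind on every runner, as
    [card_fiber_3_2] needs. *)
Lemma occupations3_range m (c : {ffun 'I_3 -> 'I_(2 * (m + 3)).+1}) :
  c \in occupations 3 (2 * (m + 3)) (3 * (m + 3)) m ->
  forall r, (2 <= c r)%N /\ (c r + 2 <= 2 * (m + 3))%N.
Proof.
move=> /mem_occupations3[a [b [xE yE zE /occupations3_bound[ba bb bab]]]].
by apply: ord3P; lia.
Qed.

(* The occupations (K + a, K + b, K - a - b) go to (1 - 3 a) - 3 b e. *)
Lemma card_occupations3 m :
  #|occupations 3 (2 * (m + 3)) (3 * (m + 3)) m| = #|` primaries (3 * m + 1)|.
Proof.
pose occ := occupations 3 (2 * (m + 3)) (3 * (m + 3)) m.
pose g (c : {ffun 'I_3 -> 'I_(2 * (m + 3)).+1}) : int * int :=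
  (1 - 3 * ((c ord0)%:Z - (m + 3)%N%:Z), - 3 * ((c (lift ord0 ord0))%:Z - (m + 3)%N%:Z)).
rewrite -/occ cardE -(size_map g).
apply/perm_size/uniq_perm => [||z].
- rewrite map_inj_in_uniq ?enum_uniq // => c d; rewrite !mem_enum.
  move=> /mem_occupations3[a [b [xE yE zE _]]] /mem_occupations3[a' [b' [xE' yE' zE' _]]] [e1 e2].
  by apply/ffunP; apply: ord3P; apply: val_inj => /=; lia.
- exact: fset_uniq.
rewrite [RHS]mem_primaries; apply/mapP/andP => [[c]|[/eqP zE /primaryP[a [b zab]]]].
  rewrite mem_enum => /mem_occupations3[a [b [xE yE zE e]]] ->.
  have -> : g c = (1 - 3 * a, - 3 * b) by rewrite /g xE yE; congr pair; ring.
  by rewrite e eqxx; split=> //; apply/primaryP; exists (- a), (- b); congr pair; ring.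
rewrite {}zab in zE *.
have {}zE : enorm (1 - 3 * (- a), - 3 * (- b)) = (3 * m + 1)%N%:Z.
  by rewrite -zE; congr enorm; congr pair; ring.
have [ba bb bab] := occupations3_bound zE.
pose x := `|((m + 3)%N%:Z - a)%R|%N; pose y := `|((m + 3)%N%:Z - b)%R|%N.
pose w := `|((m + 3)%N%:Z + a + b)%R|%N.
pose c : {ffun 'I_3 -> 'I_(2 * (m + 3)).+1} :=
  [ffun r : 'I_3 => inord (if val r == 0%N then x else if val r == 1%N then y else w)].
have cx : c ord0 = x :> nat by rewrite ffunE inordK //=; lia.
have cy : c (lift ord0 ord0) = y :> nat by rewrite ffunE inordK //=; lia.
have cw : c (lift ord0 (lift ord0 ord0)) = w :> nat by rewrite ffunE inordK //=; lia.
exists c; last by rewrite /g cx cy; congr pair; lia.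
rewrite mem_enum; apply/mem_occupations3; exists (- a), (- b).
by rewrite cx cy cw zE; split=> //; lia.
Qed.

(** * From cores to the partition counts *)

Lemma num_intpartn_ord_3_1 n : (2 < n)%N ->
  num_intpartn_ord 3 1 n = (3 * #|` primaries (3 * n - 8)|)%N.
Proof.
(* The core has size [m], so that [3 * m + 1 = 3 * n - 8]. *)
move=> n2; pose m := (n - 3)%N.
rewrite (@num_intpartn_ord_fibers 3 (2 * (m + 3)) 1 (3 * (m + 3))) //; try by rewrite /m; lia.
have -> : (n - 3 * 1 = m)%N by [].
rewrite (eq_bigr (fun=> 3%N)) => [|c cP].
  rewrite sum_nat_const card_occupations3 mulnC; congr (_ * #|` primaries _|)%N.
  by rewrite /m; lia.
have cr := occupations3_range cP.
by apply: card_fiber_3_1 => r; case: (cr r); lia.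
Qed.

Lemma num_intpartn_ord_3_2 n : (5 < n)%N ->
  num_intpartn_ord 3 2 n = (9 * #|` primaries (3 * n - 17)|)%N.
Proof.
move=> n2; pose m := (n - 6)%N.
rewrite (@num_intpartn_ord_fibers 3 (2 * (m + 3)) 2 (3 * (m + 3))) //; try by rewrite /m; lia.
have -> : (n - 3 * 2 = m)%N by [].
rewrite (eq_bigr (fun=> 9%N)) => [|c cP].
  rewrite sum_nat_const card_occupations3 mulnC; congr (_ * #|` primaries _|)%N.
  by rewrite /m; lia.
have cr := occupations3_range cP.
by apply: card_fiber_3_2 => r; case: (cr r); lia.
Qed.

Lemma num_intpartn_ord_2_1 m :
  num_intpartn_ord 2 1 (m + 2) = (#|occupations 2 (2 * (m + 3)) (2 * (m + 3)) m| * 2)%N.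
Proof.
rewrite (@num_intpartn_ord_fibers 2 (2 * (m + 3)) 1 (2 * (m + 3))) //; try by lia.
have -> : (m + 2 - 2 * 1 = m)%N by lia.
rewrite (eq_bigr (fun=> 2%N)) => [|c cP]; first by rewrite sum_nat_const.
have cr := occupations2_bound cP.
by apply: card_fiber_2_1 => r; case: (cr r); lia.
Qed.

Theorem theorem1p3 :
  (forall n : nat,
     ((exists m : nat, n%:Z - 2 = (m * (m + 1) %/ 2)%N%:Z) ->
        num_intpartn_ord 2 1 n = 2%N) /\
     (~ (exists m : nat, n%:Z - 2 = (m * (m + 1) %/ 2)%N%:Z) ->
        num_intpartn_ord 2 1 n = 0%N)) /\
  (forall n : nat, (2 < n)%N ->
     (num_intpartn_ord 3 1 n)%:Z =
       3 * \sum_(d <- divisors (3 * n - 8)) legendre d%:Z 3) /\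
  (forall n : nat, (5 < n)%N ->
     (num_intpartn_ord 3 2 n)%:Z =
       9 * \sum_(d <- divisors (3 * n - 17)) legendre d%:Z 3).
Proof.
split; last first.
  (* Both [3 * n - 8] and [3 * n - 17] are positive and 1 modulo 3, as [card_primaries] requires. *)
  split=> n n2.
    by rewrite num_intpartn_ord_3_1 // PoszM card_primaries //; lia.
  by rewrite num_intpartn_ord_3_2 // PoszM card_primaries //; lia.
(* For [n < 2] the integer [n - 2] is negative, hence not triangular, and no hook is even. *)
move=> n; have [n2|n2] := ltnP n 2.
  rewrite (num_intpartn_ord_lt (l := 2)) //; split=> // -[m]; lia.
rewrite -(subnK n2); move: (n - 2)%N => {n n2} n.
have -> : (n + 2)%N%:Z - 2 = n%:Z by rewrite PoszD addrK.
rewrite num_intpartn_ord_2_1; split=> [[t [nt]]|nt].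
  by rewrite (card_occupations2 nt).
rewrite eq_card0 // => c; apply/negP => /mem_occupations2[b [_ _ /pronic_triangular[t nE]]].
by apply: nt; exists t; rewrite -nE.
Qed.
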